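(* If a graph with largest Seidel eigenvalue $2$ is strongly maximal, then it is switching equivalent to $\overline{K_3}$. If a graph with largest Seidel eigenvalue $\sqrt{5}$ is strongly maximal, then it is switching equivalent to $C_5+K_1$.
   Context: All graphs are finite, simple, undirected, without loops. The Seidel matrix of a graph $G$ is $S(G)=\mathbf{J}-\mathbf{I}-2A(G)$, where $A(G)$ is the adjacency matrix, $\mathbf{J}$ the all-ones matrix and $\mathbf{I}$ the identity matrix; equivalently, a Seidel matrix is a symmetric matrix with zero diagonal and all off-diagonal entries $\pm1$. Seidel eigenvalues of $G$ are the eigenvalues of $S(G)$. A Seidel matrix $S$ with largest eigenvalue $\lambda$ is strongly maximal if there is no Seidel matrix $S'$ such that the largest eigenvalue of $S'$ equals $\lambda$ and $S'$ contains $S$ as a proper principal submatrix. A graph $G$ is strongly maximal if $S(G)$ is. For a graph $G=(V,E)$ and $U\subseteq V$, the graph $G^U$ obtained by switching with respect to $U$ has vertex set $V$ and is obtained from $G$ by keeping adjacency between pairs inside $U$ and pairs inside $V\setminus U$, and reversing adjacency between each vertex of $U$ and each vertex of $V\setminus U$. Two graphs are switching equivalent if one is isomorphic to a graph obtained from the other by switching. $\overline{K_3}$ is the edgeless graph on $3$ vertices, $C_5$ the $5$-cycle, $K_1$ the one-vertex graph, and $G+H$ the disjoint union of $G$ and $H$. *)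

(* Defs.v *)
From HB Require Import structures.
From mathcomp Require Import all_boot all_order all_algebra.

Set Implicit Arguments.
Unset Strict Implicit.
Unset Printing Implicit Defensive.

Import Order.TTheory GRing.Theory Num.Theory.

Record graph (V : finType) := Graph {
  adj : rel V;
  adj_sym : symmetric adj;
  adj_irr : irreflexive adj }.

Definition isomorphic (V W : finType) (G : graph V) (H : graph W) : Prop :=
  exists2 f : V -> W, bijective f & forall x y, adj H (f x) (f y) = adj G x y.

Section Switching.
Variables (V : finType) (G : graph V) (U : {set V}).

Definition switch_adj : rel V :=
  fun x y => adj G x y (+) ((x \in U) (+) (y \in U)).

Lemma switch_sym : symmetric switch_adj.
Proof.
by move=> x y; rewrite /switch_adj adj_sym [(x \in U) (+) _]addbC.
Qed.

Lemma switch_irr : irreflexive switch_adj.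
Proof. by move=> x; rewrite /switch_adj adj_irr addbb. Qed.

Definition switch : graph V := Graph switch_sym switch_irr.
End Switching.

Definition switching_equivalent
    (V W : finType) (G : graph V) (H : graph W) : Prop :=
  exists U : {set V}, isomorphic (switch G U) H.

Section DisjointUnion.
Variables (V W : finType) (G : graph V) (H : graph W).

Definition disjoint_union_adj : rel (V + W)%type := fun x y =>
  match x, y with
  | inl a, inl b => adj G a b
  | inr a, inr b => adj H a b
  | _, _ => false
  end.

Lemma disjoint_union_sym : symmetric disjoint_union_adj.
Proof. by move=> [a|a] [b|b] //=; rewrite adj_sym. Qed.

Lemma disjoint_union_irr : irreflexive disjoint_union_adj.
Proof. by move=> [a|a] /=; rewrite adj_irr. Qed.

Definition disjoint_union : graph (V + W)%type :=
  Graph disjoint_union_sym disjoint_union_irr.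
End DisjointUnion.

Section NamedGraphs.
Variable n : nat.

Lemma edgeless_sym : symmetric (fun _ _ : 'I_n => false).
Proof. by []. Qed.

Lemma edgeless_irr : irreflexive (fun _ _ : 'I_n => false).
Proof. by []. Qed.

Definition edgeless : graph 'I_n := Graph edgeless_sym edgeless_irr.

Lemma complete_sym : symmetric (fun i j : 'I_n => i != j).
Proof. by move=> i j; rewrite eq_sym. Qed.

Lemma complete_irr : irreflexive (fun i j : 'I_n => i != j).
Proof. by move=> i; rewrite eqxx. Qed.

Definition complete : graph 'I_n := Graph complete_sym complete_irr.
End NamedGraphs.

Definition C5_adj : rel 'I_5 :=
  fun i j => (i.+1 %% 5 == j) || (j.+1 %% 5 == i).

Lemma C5_sym : symmetric C5_adj.
Proof. by move=> i j; rewrite /C5_adj orbC. Qed.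

Lemma C5_irr : irreflexive C5_adj.
Proof. by case=> [[|[|[|[|[|i]]]]] hi]. Qed.

Definition C5 : graph 'I_5 := Graph C5_sym C5_irr.

Local Open Scope ring_scope.

Definition adjacency_mx (R : pzRingType) (V : finType) (G : graph V) :
    'M[R]_#|V| :=
  \matrix_(i, j) (adj G (enum_val i) (enum_val j))%:R.

Definition seidel_mx (R : pzRingType) (V : finType) (G : graph V) :
    'M[R]_#|V| :=
  const_mx 1 - 1%:M - 2%:R *: adjacency_mx R G.

Definition is_seidel (R : pzRingType) (n : nat) (S : 'M[R]_n) : Prop :=
  [/\ S^T = S,
      forall i, S i i = 0
    & forall i j, i != j -> S i j = 1 \/ S i j = -1].

Definition largest_eigenvalue (R : realFieldType) (n : nat) (S : 'M[R]_n)
    (lambda : R) : Prop :=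
  eigenvalue S lambda /\ forall mu, eigenvalue S mu -> mu <= lambda.

(* A strictly increasing f selects the rows and columns that are kept; with
   n < m, at least one index is deleted. *)
Definition proper_principal_submx (R : Type) (n m : nat)
    (S : 'M[R]_n) (S' : 'M[R]_m) : Prop :=
  (n < m)%N /\
  exists2 f : 'I_n -> 'I_m,
    (forall i j : 'I_n, (i < j)%N -> (f i < f j)%N) & S = mxsub f f S'.

Definition strongly_maximal_mx (R : realFieldType) (n : nat) (S : 'M[R]_n) :
    Prop :=
  is_seidel S /\
  exists2 lambda : R, largest_eigenvalue S lambda &
    ~ exists m, exists S' : 'M[R]_m,
        [/\ is_seidel S', largest_eigenvalue S' lambda
          & proper_principal_submx S S'].

Definition strongly_maximal (R : realFieldType) (V : finType) (G : graph V) :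
    Prop :=
  strongly_maximal_mx (seidel_mx R G).

(* Main.v *)
Require Import Defs.
From mathcomp Require Import all_boot all_order all_algebra.
From mathcomp Require Import complex ring lra.

(** For a sign matrix S with largest eigenvalue lambda, the quadratic form
    lambda I - S is positive semidefinite
    ([largest_eigenvalue_rayleigh], from the spectral theorem over the complex
    closure). The engine of the whole proof is the equality case: a vector
    supported on a set A of vertices and satisfying the eigenvalue equation on
    A for the same lambda, extended by zero, attains the maximum of the
    Rayleigh quotient, hence is an eigenvector of all of S. So every further
    vertex z has a row orthogonal to that vector
    ([eigenfun_subset_orthogonal]). As the row of z is a sign vector, this
    leaves very few possibilities.

    Everything is expressed through the sign of a triple abc, the product
    S_ab S_bc S_ac, which switching does not change. If all triples
    through a vertex had the same sign, then S would be, up to switching, J - I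
    or I - J, whose eigenvalues are known; hence there is a triple of sign 1 in
    both cases ([exists_triple]).

    Case lambda = 2. A positive triple is switching equivalent to J - I and
    already has eigenvalue 2, with eigenvector (1, 1, 1) up to switching. A
    fourth vertex would need three signs with sum zero, which is impossible by
    parity. So the graph is the triple itself.

    Case lambda = sqrt 5. Four vertices with all triples positive would give
    the eigenvalue 3, and not all triples are positive, so there are four
    vertices a, b, c, d whose positive triples are exactly abc and abd
    ([exists_quadruple]). They carry the eigenvector (1, 1, y, y) with
    y = (sqrt 5 - 1) / 2, up to switching. Since 0 < y < 1, orthogonality
    forces the signs of a further vertex to be opposite on a and b, and
    opposite on c and d ([quadruple_orthogonal]): up to switching, two types of
    vertices remain. Applying the same rule to another quadruple, one that
    contains the new vertex, shows that each type occurs at most once and that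
    the two types see each other with sign 1 ([quadruple_outside_pair]). The
    resulting pattern on six vertices is the Seidel matrix C of C5 + K1, so
    the graph embeds, up to switching, in C5 + K1 ([switched_C5K1]).

    Finally C ^ 2 = 5 I, so sqrt 5 bounds the form of C and of all its
    principal submatrices ([C5K1_form_bounded]). If the embedding missed a
    vertex, adding that vertex would give a larger Seidel matrix with the same
    largest eigenvalue, against strong maximality
    ([switched_not_strongly_maximal]). So the embedding is onto. *)

Set Implicit Arguments. Unset Strict Implicit. Unset Printing Implicit Defensive.
Import Order.TTheory GRing.Theory Num.Theory.
Local Open Scope ring_scope.

(** * The Rayleigh bound *)

(** The ground field is only real closed, so S is diagonalized by a unitary
    matrix over R[i]: the diagonal entries are real because S is symmetric, and
    are therefore eigenvalues of S over R, hence at most lambda. *)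
Lemma largest_eigenvalue_rayleigh (R : rcfType) n (S : 'M[R]_n) lambda
    (y : 'rV[R]_n) :
  S^T = S -> largest_eigenvalue S lambda ->
  (y *m S *m y^T) 0 0 <= lambda * (y *m y^T) 0 0.
Proof.
move=> symS [_ maxS].
pose toC : {rmorphism R -> R[i]} := real_complex R.
have real_toC m p (B : 'M[R]_(m, p)) : map_mx toC B \is a mxOver Num.real.
  by apply/mxOverP => i j; rewrite mxE; apply/complex_realP; exists (B i j).
pose A := map_mx toC S.
have hermA : A \is hermsymmx.
  apply: realsym_hermsym; last exact: real_toC.
  apply/is_hermitianmxP.
  by rewrite expr0 scale1r map_mx_id // map_trmx symS.
have /orthomx_spectralP := hermitian_normalmx hermA.
have := hermitian_spectral_diag_real hermA.
set D := spectral_diag A; set P := spectralmx A => realD eqA.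
have unitP : P \in unitmx := spectral_unit A.
have invP : invmx P = map_mx Num.conj P^T.
  exact: invmx_unitary (spectral_unitarymx A).
have D_le i : D 0 i <= toC lambda.
  have [k Dk] : exists k, D 0 i = toC k by apply/complex_realP/mxOverP.
  rewrite Dk lecR; apply: maxS.
  rewrite eigenvalue_root_char -(fmorph_root toC) map_char_poly.
  rewrite -[map_mx _ _]/A -eigenvalue_root_char.
  apply/eigenvalueP; exists (row i P).
    rewrite {1}eqA -mulmxA -row_mul !mulmxA mulmxV // mul1mx mul_diag_mx.
    by apply/rowP => j; rewrite !mxE Dk.
  apply/eqP => /(congr1 (mulmx^~ (invmx P))).
  rewrite -row_mul mulmxV // mul0mx => /rowP/(_ i).
  by rewrite !mxE eqxx => /eqP; rewrite oner_eq0.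
(* z is the vector of coordinates of y in the orthonormal eigenbasis. *)
pose z := map_mx toC y *m invmx P.
have conj_z : P *m (map_mx toC y)^T = map_mx Num.conj z^T.
  rewrite /z invP trmx_mul map_mxM trmxCK.
  congr (_ *m _); apply/colP => j; rewrite !mxE /=.
  by rewrite (CrealP _) //; apply/complex_realP; exists (y 0 j).
have toC_le (a b : R) : toC a <= toC b -> a <= b by rewrite lecR.
apply: toC_le.
rewrite rmorphM /=.
have -> : toC ((y *m S *m y^T) 0 0) = \sum_i D 0 i * `|z 0 i| ^+ 2.
  transitivity ((z *m diag_mx D *m map_mx Num.conj z^T) 0 0).
    have -> : z *m diag_mx D *m map_mx Num.conj z^T
            = map_mx toC y *m A *m (map_mx toC y)^T.
      by rewrite eqA -conj_z /z !mulmxA.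
    by rewrite map_trmx -!map_mxM [RHS]mxE.
  rewrite mul_mx_diag mxE; apply: eq_bigr => i _.
  by rewrite !mxE mulrAC normCK mulrC mulrA.
have -> : toC ((y *m y^T) 0 0) = \sum_i `|z 0 i| ^+ 2.
  transitivity ((z *m map_mx Num.conj z^T) 0 0).
    rewrite -conj_z /z !mulmxA mulmxKV //.
    by rewrite map_trmx -!map_mxM [RHS]mxE.
  by rewrite mxE; apply: eq_bigr => i _; rewrite !mxE normCK.
rewrite mulr_sumr; apply: ler_sum => i _.
by rewrite ler_wpM2r // exprn_ge0.
Qed.

(** * Quadratic forms on finite index types *)

Section QuadraticForms.
Variable R : realFieldType.
Implicit Types (T U : finType).

Definition apply_kernel T (F : T -> T -> R) (x : T -> R) (t : T) : R :=
  \sum_v F t v * x v.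

Definition quad_form T (F : T -> T -> R) (x : T -> R) : R :=
  \sum_t x t * apply_kernel F x t.

Definition sq_norm T (x : T -> R) : R := \sum_t x t ^+ 2.

(** The condition that [lambda I - F] is positive semidefinite. *)
Definition form_bounded T (F : T -> T -> R) (lambda : R) : Prop :=
  forall x, quad_form F x <= lambda * sq_norm x.

Definition eigenfun T (F : T -> T -> R) (lambda : R) (x : T -> R) : Prop :=
  forall t, apply_kernel F x t = lambda * x t.

(** For an injective [h], this is the extension of [x] by zero along [h]. *)
Definition pushforward T U (h : U -> T) (x : U -> R) (t : T) : R :=
  \sum_(u | h u == t) x u.

Lemma sum_indicator T (g : T -> R) t : \sum_v g v * (v == t)%:R = g t.
Proof.
rewrite (bigD1 t) //= eqxx mulr1 big1 ?addr0 // => w /negPf->.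
by rewrite mulr0.
Qed.

Lemma apply_kernel_perturb T (F : T -> T -> R) x s t v :
  apply_kernel F (fun w => x w + s * (w == t)%:R) v
    = apply_kernel F x v + s * F v t.
Proof.
rewrite -(sum_indicator (F v)) mulr_sumr -big_split.
by apply: eq_bigr => w _; rewrite mulrDr mulrCA.
Qed.

Lemma quad_form_perturb T (F : T -> T -> R) x s t :
  (forall u v, F u v = F v u) ->
  quad_form F (fun w => x w + s * (w == t)%:R)
    = quad_form F x + 2%:R * s * apply_kernel F x t + s ^+ 2 * F t t.
Proof.
move=> symF; rewrite /quad_form.
under eq_bigr => v _ do rewrite apply_kernel_perturb.
rewrite (eq_bigr (fun v => x v * apply_kernel F x v
    + (s * (F t v * x v)
    + s * ((apply_kernel F x v + s * F v t) * (v == t)%:R)))); last first.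
  by move=> v _; rewrite (symF t v); move: (_%:R) => d; ring.
rewrite !big_split /= -!mulr_sumr sum_indicator -/(apply_kernel F x t).
by ring.
Qed.

Lemma sq_norm_perturb T (x : T -> R) s t :
  sq_norm (fun w => x w + s * (w == t)%:R)
    = sq_norm x + 2%:R * s * x t + s ^+ 2.
Proof.
rewrite /sq_norm (eq_bigr (fun v => x v ^+ 2
    + s * ((2%:R * x v + s * (v == t)%:R) * (v == t)%:R))); last first.
  by move=> v _; move: (_ == _)%:R => d; ring.
rewrite big_split /= -mulr_sumr sum_indicator eqxx (_ : true%:R = 1) //.
by ring.
Qed.

(** A maximizer of the Rayleigh quotient is a critical point: along the line
    through [x] in the direction of the basis vector at [t], the inequality
    says that [2 s g <= k s ^ 2] for every [s], where [g] is the defect of the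
    eigenvalue equation at [t]; this forces [g = 0]. *)
Lemma form_bounded_eigenfun T (F : T -> T -> R) lambda x :
  (forall u v, F u v = F v u) -> form_bounded F lambda ->
  quad_form F x = lambda * sq_norm x -> eigenfun F lambda x.
Proof.
move=> symF bndF eqx t.
pose g := apply_kernel F x t - lambda * x t.
pose k := lambda - F t t.
have gk s : 2%:R * s * g <= k * s ^+ 2.
  have := bndF (fun w => x w + s * (w == t)%:R).
  rewrite quad_form_perturb // sq_norm_perturb eqx /g /k => H.
  by rewrite -subr_ge0; rewrite -subr_ge0 in H; apply: le_trans H _; lra.
suff /eqP : g = 0 by rewrite subr_eq0 => /eqP.
pose K := `|k| + 1.
have K0 : 0 < K by rewrite /K; have := normr_ge0 k; lra.
have kK : k <= K by rewrite /K; have := ler_norm k; lra.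
(* The test value s = g / K, with K > 0 and k <= K, gives 2 K s^2 <= K s^2. *)
have gs : g = K * (g / K) by rewrite mulrC divfK // gt_eqF.
have := gk (g / K); set s := g / K in gs *; rewrite gs => Hs.
have s0 : s ^+ 2 = 0.
  apply/le_anti; rewrite sqr_ge0 andbT.
  have h1 : k * s ^+ 2 <= K * s ^+ 2 by rewrite ler_wpM2r ?sqr_ge0.
  rewrite -(pmulr_rle0 _ K0); lra.
by move/eqP: s0; rewrite sqrf_eq0 => /eqP->; rewrite mulr0.
Qed.

Lemma sum_pushforward T U (h : U -> T) x (g : T -> R) :
  \sum_t g t * pushforward h x t = \sum_u g (h u) * x u.
Proof.
rewrite [RHS](partition_big h xpredT) //=; apply: eq_bigr => t _.
by rewrite mulr_sumr; apply: eq_bigr => u /eqP->.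
Qed.

Lemma pushforward_inj T U (h : U -> T) x u :
  injective h -> pushforward h x (h u) = x u.
Proof.
by move=> injh; rewrite /pushforward (big_pred1 u) // => v; exact: inj_eq.
Qed.

Lemma pushforward_notin T U (h : U -> T) x t :
  (forall u, h u != t) -> pushforward h x t = 0.
Proof. by move=> ht; apply: big1 => u; rewrite (negPf (ht u)). Qed.

Lemma apply_kernel_pushforward T U (F : T -> T -> R) (h : U -> T) x t :
  apply_kernel F (pushforward h x) t = \sum_u F t (h u) * x u.
Proof. exact: sum_pushforward. Qed.

Lemma quad_form_pushforward T U (F : T -> T -> R) (h : U -> T) x :
  quad_form F (pushforward h x) = quad_form (fun u v => F (h u) (h v)) x.
Proof.
rewrite /quad_form; under eq_bigr do rewrite mulrC.
rewrite sum_pushforward; apply: eq_bigr => u _.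
by rewrite apply_kernel_pushforward mulrC.
Qed.

Lemma sq_norm_pushforward T U (h : U -> T) x :
  injective h -> sq_norm (pushforward h x) = sq_norm x.
Proof.
move=> injh; rewrite /sq_norm; under eq_bigr do rewrite expr2.
by rewrite sum_pushforward; apply: eq_bigr => u _; rewrite pushforward_inj.
Qed.

Lemma form_bounded_restrict T U (F : T -> T -> R) (h : U -> T) lambda :
  injective h -> form_bounded F lambda ->
  form_bounded (fun u v => F (h u) (h v)) lambda.
Proof.
move=> injh bndF x.
by rewrite -quad_form_pushforward -(sq_norm_pushforward x injh).
Qed.

Lemma form_bounded_switch T (F : T -> T -> R) (e : T -> R) lambda :
  (forall t, e t ^+ 2 = 1) -> form_bounded F lambda ->
  form_bounded (fun u v => e u * e v * F u v) lambda.
Proof.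
move=> e1 bndF x; have := bndF (fun t => e t * x t).
rewrite /sq_norm; under [X in _ <= _ * X]eq_bigr do rewrite exprMn e1 mul1r.
congr (_ <= _); apply: eq_bigr => t _.
rewrite /apply_kernel !mulr_sumr; apply: eq_bigr => v _.
by ring.
Qed.

Lemma eigenfun_quad_form T (F : T -> T -> R) lambda x :
  eigenfun F lambda x -> quad_form F x = lambda * sq_norm x.
Proof.
move=> eigx; rewrite /quad_form /sq_norm mulr_sumr.
by apply: eq_bigr => t _; rewrite eigx; ring.
Qed.

(** An eigenvector of a principal submatrix for the extremal value [lambda],
    extended by zero, has the same Rayleigh quotient, hence is an eigenvector
    of the whole matrix. *)
Lemma eigenfun_pushforward T U (F : T -> T -> R) (h : U -> T) lambda x :
  (forall u v, F u v = F v u) -> form_bounded F lambda -> injective h ->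
  eigenfun (fun u v => F (h u) (h v)) lambda x ->
  eigenfun F lambda (pushforward h x).
Proof.
move=> symF bndF injh eigx; apply: form_bounded_eigenfun => //.
by rewrite quad_form_pushforward sq_norm_pushforward // (eigenfun_quad_form eigx).
Qed.

(** The row of the extended eigenvector equation at a vertex [z] outside [s],
    where the extended vector vanishes. *)
Lemma eigenfun_subset_orthogonal T (F : T -> T -> R) lambda (s : seq T)
    (x : seq R) (z : T) :
  (forall u v, F u v = F v u) -> form_bounded F lambda ->
  uniq s -> z \notin s ->
  (forall i : 'I_(size s),
     \sum_(j < size s) F (nth z s i) (nth z s j) * x`_j = lambda * x`_i) ->
  \sum_(j < size s) F z (nth z s j) * x`_j = 0.
Proof.
move=> symF bndF us zs eigx.
pose h (i : 'I_(size s)) := nth z s i.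
have injh : injective h.
  by move=> i j /eqP; rewrite nth_uniq // => /eqP/val_inj.
have := eigenfun_pushforward symF bndF injh (x := fun i : 'I_(size s) => x`_i) eigx z.
rewrite apply_kernel_pushforward pushforward_notin ?mulr0 // => i.
by apply: contra zs => /eqP<-; exact: mem_nth.
Qed.

End QuadraticForms.

(** * Seidel matrices and signs of triples *)

Section SeidelKernels.
Variable R : realFieldType.
Implicit Types (T U : finType).

(** Seidel matrices indexed by an arbitrary finite type. *)
Record seidel_kernel T (F : T -> T -> R) : Prop := SeidelKernel {
  seidel_sym : forall u v, F u v = F v u;
  seidel_diag : forall u, F u u = 0;
  seidel_offdiag : forall u v, u != v -> F u v = 1 \/ F u v = -1 }.

(** [F] is, after conjugation by the diagonal sign matrix [e], a principal
    submatrix of [H]. *)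
Definition switched T U (F : T -> T -> R) (H : U -> U -> R) (e : T -> R)
    (f : T -> U) : Prop :=
  [/\ injective f, forall t, e t ^+ 2 = 1
    & forall u v, F u v = e u * e v * H (f u) (f v)].

Lemma sqr_pm1 (x : R) : x = 1 \/ x = -1 -> x ^+ 2 = 1.
Proof. by case=> ->; rewrite ?sqrrN expr1n. Qed.

Lemma sqr_eq1 (x : R) : x ^+ 2 = 1 -> x = 1 \/ x = -1.
Proof. by move=> /eqP; rewrite sqrf_eq1 => /orP[]/eqP; auto. Qed.

Lemma seidel_sqr T (F : T -> T -> R) u v :
  seidel_kernel F -> u != v -> F u v ^+ 2 = 1.
Proof. by move=> SF /(seidel_offdiag SF)/sqr_pm1. Qed.

(** Here [F = s (e e^T - I)], so the eigenvalue equation reads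
    [(lambda + s) e_t x_t = s X] with [X] the sum of the [e_v x_v]; summing
    over [t] gives [X = 0], hence [lambda = - s], or [lambda = s (n - 1)]. *)
Lemma rank_one_seidel_eigenvalue T (F : T -> T -> R) (e : T -> R) s lambda x :
  s ^+ 2 = 1 -> (forall t, e t ^+ 2 = 1) -> (forall t, F t t = 0) ->
  (forall u v, u != v -> F u v = s * e u * e v) ->
  eigenfun F lambda x -> (exists t, x t != 0) ->
  lambda = - s \/ lambda = s * (#|T|%:R - 1).
Proof.
move=> s1 e1 F0 Fe eigx [t0 xt0].
pose X := \sum_t e t * x t.
have row t : (lambda + s) * (e t * x t) = s * X.
  have := eigx t; rewrite /apply_kernel (bigD1 t) //= F0 mul0r add0r.
  rewrite (eq_bigr (fun v => s * e t * (e v * x v))); last first.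
    by move=> v; rewrite eq_sym => /Fe->; rewrite mulrA.
  rewrite -mulr_sumr => eqt.
  rewrite mulrDl mulrCA -eqt /X [in RHS](bigD1 t) //= mulrDr.
  rewrite addrC mulrA [e t * (_ * _)]mulrCA; congr (_ + _).
  by rewrite !mulrA -(mulrA s) -expr2 e1 mulr1.
have : (lambda + s) * X = s * #|T|%:R * X.
  rewrite {1}/X mulr_sumr (eq_bigr _ (fun t _ => row t)) sumr_const.
  by rewrite -[in LHS]mulr_natr; ring.
have [X0 _|X0 /(mulIf X0) eql] := eqVneq X 0; last by right; lra.
left; apply/eqP; rewrite -subr_eq0 opprK.
have := row t0; rewrite X0 mulr0 => /eqP; rewrite !mulf_eq0 (negPf xt0) orbF.
by case/orP => // /eqP e0; move: (e1 t0) => /eqP; rewrite e0 expr0n eq_sym oner_eq0.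
Qed.

(** Switching with these signs makes all entries of the row of [a] equal
    to 1. *)
Definition base_sign T (F : T -> T -> R) (a t : T) : R :=
  if t == a then 1 else F a t.

Lemma base_sign_sqr T (F : T -> T -> R) a t :
  seidel_kernel F -> base_sign F a t ^+ 2 = 1.
Proof.
rewrite /base_sign => SF; case: eqVneq => [_|ta]; first by rewrite expr1n.
by rewrite seidel_sqr // eq_sym.
Qed.

(** If every triple through [a] has sign [- s], then [F] is the switching of
    [- s (J - I)] by the row of [a], and the two excluded values are its only
    eigenvalues. *)
Lemma exists_triple T (F : T -> T -> R) (a : T) s lambda x :
  seidel_kernel F -> s ^+ 2 = 1 -> eigenfun F lambda x ->
  (exists t, x t != 0) ->
  lambda != s -> lambda != - s * (#|T|%:R - 1) ->
  exists b c, [/\ a != b, a != c, b != c & F a b * F b c * F a c = s].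
Proof.
move=> SF s1 eigx x0 ls ln.
have [/existsP[b /existsP[c /and4P[ab ac bc /eqP abc]]]|noex] :=
  boolP [exists b, exists c,
    [&& a != b, a != c, b != c & F a b * F b c * F a c == s]].
  by exists b, c.
have sN1 : (- s) ^+ 2 = 1 by rewrite sqrrN.
have triple b c : a != b -> a != c -> b != c -> F a b * F b c * F a c = - s.
  move=> ab ac bc; apply/eqP; apply: contraNT noex => nes.
  apply/existsP; exists b; apply/existsP; exists c; rewrite ab ac bc /=.
  have /eqP : (F a b * F b c * F a c) ^+ 2 = s ^+ 2.
    by rewrite !exprMn !(seidel_sqr SF) // !mulr1 s1.
  by rewrite eqf_sqr (negPf nes) orbF.
exfalso.
pose e t : R := if t == a then 1 else - s * F a t.
have e1 t : e t ^+ 2 = 1.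
  rewrite /e; case: eqVneq => [_|ta]; first by rewrite expr1n.
  by rewrite exprMn sN1 mul1r seidel_sqr // eq_sym.
have Fe u v : u != v -> F u v = - s * e u * e v.
  have sqA w : w != a -> F a w ^+ 2 = 1.
    by move=> wa; rewrite seidel_sqr // eq_sym.
  rewrite /e; have [->|ua] := eqVneq u a; have [->|va] := eqVneq v a => // uv.
  - by rewrite mulr1 mulrA -expr2 sN1 mul1r.
  - by rewrite mulr1 mulrA -expr2 sN1 mul1r (seidel_sym SF).
  transitivity (F a u ^+ 2 * F a v ^+ 2 * F u v).
    by rewrite !sqA // !mul1r.
  transitivity (F a u * F u v * F a v * (F a u * F a v)); first by ring.
  rewrite triple ?(eq_sym a) //.
  transitivity ((- s) ^+ 2 * - s * (F a u * F a v)); last by ring.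
  by rewrite sN1 mul1r.
have [] := rank_one_seidel_eigenvalue sN1 e1 (seidel_diag SF) Fe eigx x0.
  by move/eqP; rewrite opprK (negPf ls).
by move/eqP; rewrite (negPf ln).
Qed.

Lemma sum_pm1_neq0 (p q r : R) :
  p = 1 \/ p = -1 -> q = 1 \/ q = -1 -> r = 1 \/ r = -1 -> p + q + r <> 0.
Proof. by do 3! case=> ->; lra. Qed.

(** A positive triple carries the eigenvector (1, F a b, F a c) for 2, and a
    sum of three signs is odd, so no row can be orthogonal to it. *)
Lemma positive_triple_spanning T (F : T -> T -> R) a b c :
  seidel_kernel F -> form_bounded F 2%:R ->
  a != b -> a != c -> b != c -> F a b * F b c * F a c = 1 ->
  forall z, z \in [:: a; b; c].
Proof.
move=> SF bndF ab ac bc abc z; apply/negPn/negP => zs.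
have symF := seidel_sym SF.
have offF := seidel_offdiag SF.
have us : uniq [:: a; b; c] by rewrite /= !inE negb_or ab ac bc.
have : \sum_(j < 3) F z (nth z [:: a; b; c] j) * [:: 1; F a b; F a c]`_j = 0.
  apply: (eigenfun_subset_orthogonal symF bndF us zs) => i.
  rewrite !big_ord_recl big_ord0.
  case: i => -[|[|[|//]]] _ /=;
    rewrite ?(seidel_diag SF) ?(symF b a) ?(symF c a) ?(symF c b);
    move: abc (offF _ _ ab) (offF _ _ ac) (offF _ _ bc);
    move: (F a b) (F b c) (F a c) => p q r + [] ? [] ? [] ?; subst; lra.
rewrite !big_ord_recl big_ord0 /= mulr1 addr0 addrA.
move: zs; rewrite !inE !negb_or => /and3P[za zb zc].
apply: sum_pm1_neq0; first exact: offF.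
  by case: (offF _ _ zb) (offF _ _ ab) => -> [] ->; lra.
by case: (offF _ _ zc) (offF _ _ ac) => -> [] ->; lra.
Qed.

Lemma pm1_mul (p q : R) :
  p = 1 \/ p = -1 -> q = 1 \/ q = -1 -> p * q = 1 \/ p * q = -1.
Proof. by move=> [] -> [] ->; rewrite ?mul1r ?mulN1r ?opprK; auto. Qed.

Lemma triple_third (p q x s : R) :
  p ^+ 2 = 1 -> q ^+ 2 = 1 -> p * x * q = s -> x = s * p * q.
Proof.
move=> p1 q1 <-; transitivity (p ^+ 2 * q ^+ 2 * x); last by ring.
by rewrite p1 q1 !mul1r.
Qed.

Lemma uniq4P T (a b c d : T) : uniq [:: a; b; c; d] ->
  [/\ a != b, a != c & a != d] /\ [/\ b != c, b != d & c != d].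
Proof.
rewrite /= !inE !negb_or.
by case/and4P => /and3P[-> -> ->] /andP[-> ->] ->.
Qed.

(** * Quadruples for the square root of 5 *)

(** The triples abc and abd are positive and acd is negative; bcd is then
    negative, since the product of the four signs is 1. This is the switching
    class of the path on four vertices, whose largest Seidel eigenvalue is the
    square root of 5. *)
Definition quadruple T (F : T -> T -> R) (a b c d : T) : Prop :=
  [/\ uniq [:: a; b; c; d], F a b * F b c * F a c = 1,
      F a b * F b d * F a d = 1 & F a c * F c d * F a d = -1].

Section SquareRootFive.
Variable r : R.
Hypotheses (r_ge0 : 0 <= r) (r2 : r ^+ 2 = 5%:R).

Lemma sqrt5_bounds : 2%:R < r < 3%:R.
Proof. by have := r2; have := r_ge0; move=> *; apply/andP; split; nra. Qed.

Lemma sqrt5_neq_nat n : r != n%:R.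
Proof.
have /andP[r_gt2 r_lt3] := sqrt5_bounds.
apply/eqP => rn; move: r_gt2 r_lt3; rewrite rn !ltr_nat => n2 n3.
by have := leq_trans n2 (n3 : (n <= 2)%N); rewrite ltnn.
Qed.

(** The quadruple carries the eigenvector (1, F a b, y F a c, y F a d) with
    [y = (r - 1) / 2]. For signs p, q, s, t the relation
    [p + q + y (s + t) = 0] with [1/2 < y < 1] forces [q = - p] and
    [t = - s]. *)
Lemma quadruple_orthogonal T (F : T -> T -> R) a b c d z :
  seidel_kernel F -> form_bounded F r -> quadruple F a b c d ->
  z \notin [:: a; b; c; d] ->
  F z a * F z b = - F a b /\ F z c * F z d = - (F a c * F a d).
Proof.
move=> SF bndF [us abc abd acd] zs.
have /andP[r_gt2 r_lt3] := sqrt5_bounds.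
have symF := seidel_sym SF; have offF := seidel_offdiag SF.
pose y : R := (r - 1) / 2%:R.
have yE : r = 1 + 2%:R * y by rewrite /y; lra.
have y2 : r * y = 2%:R - y by rewrite /y; have := r2; lra.
have y0 : 1 < 2%:R * y by lra.
have y1 : y < 1 by lra.
clearbody y.
have [[ab ac ad] [bc bd cd]] := uniq4P us.
have Fbc := triple_third (seidel_sqr SF ab) (seidel_sqr SF ac) abc.
have Fbd := triple_third (seidel_sqr SF ab) (seidel_sqr SF ad) abd.
have Fcd := triple_third (seidel_sqr SF ac) (seidel_sqr SF ad) acd.
move: zs; rewrite !inE !negb_or => /and4P[za zb zc zd].
have : \sum_(j < 4) F z (nth z [:: a; b; c; d] j)
    * [:: 1; F a b; y * F a c; y * F a d]`_j = 0.
  apply: (eigenfun_subset_orthogonal symF bndF us) => [|i].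
    by rewrite !inE !negb_or za zb zc zd.
  rewrite !big_ord_recl big_ord0.
  case: i => -[|[|[|[|//]]]] _ /=;
    rewrite ?(seidel_diag SF) ?(symF b a) ?(symF c a) ?(symF d a)
      ?(symF c b) ?(symF d b) ?(symF d c);
    rewrite ?Fbc ?Fbd ?Fcd;
    by case: (offF _ _ ab) => ->; case: (offF _ _ ac) => ->;
      case: (offF _ _ ad) => ->; clear - yE y2; lra.
rewrite !big_ord_recl big_ord0 /=.
rewrite mulr1 addr0 => orth.
have [eq_b eq_d] : F z b * F a b = - F z a /\ F z d * F a d = - (F z c * F a c).
  have vb := pm1_mul (offF _ _ zb) (offF _ _ ab).
  have vc := pm1_mul (offF _ _ zc) (offF _ _ ac).
  have vd := pm1_mul (offF _ _ zd) (offF _ _ ad).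
  have {}orth : F z a + F z b * F a b + y * (F z c * F a c)
      + y * (F z d * F a d) = 0 by rewrite -[RHS]orth; ring.
  case: (offF _ _ za) vb vc vd orth => -> [] -> [] -> [] ->;
    clear - y0 y1 => ?; split; lra.
split.
  transitivity (- (F z b * F a b) * F z b); first by rewrite eq_b opprK.
  transitivity (- (F z b ^+ 2 * F a b)); first by ring.
  by rewrite seidel_sqr // mul1r.
transitivity (F z c * (F z d * F a d) * F a d).
  transitivity (F z c * F z d * F a d ^+ 2); last by ring.
  by rewrite (seidel_sqr SF ad) mulr1.
rewrite eq_d; transitivity (- (F z c ^+ 2 * (F a c * F a d))); first by ring.
by rewrite seidel_sqr // mul1r.
Qed.

(** Four vertices with all triples positive are switching equivalent to
    J - I, of largest eigenvalue 3. *)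
Lemma no_positive_quadruple T (F : T -> T -> R) a b c d :
  seidel_kernel F -> form_bounded F r -> uniq [:: a; b; c; d] ->
  F a b * F b c * F a c = 1 -> F a b * F b d * F a d = 1 ->
  F a c * F c d * F a d <> 1.
Proof.
move=> SF bndF us abc abd acd.
have /andP[r_gt2 r_lt3] := sqrt5_bounds.
have symF := seidel_sym SF; have offF := seidel_offdiag SF.
pose h (i : 'I_4) := nth a [:: a; b; c; d] i.
have injh : injective h.
  by move=> i j /eqP; rewrite nth_uniq // => /eqP/val_inj.
have [[ab ac ad] [bc bd cd]] := uniq4P us.
have Fbc := triple_third (seidel_sqr SF ab) (seidel_sqr SF ac) abc.
have Fbd := triple_third (seidel_sqr SF ab) (seidel_sqr SF ad) abd.
have Fcd := triple_third (seidel_sqr SF ac) (seidel_sqr SF ad) acd.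
have := form_bounded_restrict injh bndF
  (fun i : 'I_4 => [:: 1; F a b; F a c; F a d]`_i).
rewrite /quad_form /sq_norm /apply_kernel !big_ord_recl !big_ord0 /h /=.
rewrite ?(seidel_diag SF) ?(symF b a) ?(symF c a) ?(symF d a)
      ?(symF c b) ?(symF d b) ?(symF d c).
rewrite ?Fbc ?Fbd ?Fcd.
by case: (offF _ _ ab) => ->; case: (offF _ _ ac) => ->;
  case: (offF _ _ ad) => ->; lra.
Qed.

(** A positive triple abc exists, and not all triples through [a] are positive,
    so there is a fourth vertex [d]. The number of positive triples in abcd is
    even, nonzero and different from 4, so exactly one of abd, acd, bcd is
    positive, and it shares with abc the pair that comes first in the
    quadruple. *)
Lemma exists_quadruple T (F : T -> T -> R) (a : T) x :
  seidel_kernel F -> form_bounded F r -> eigenfun F r x ->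
  (exists t, x t != 0) ->
  exists p q s t, quadruple F p q s t.
Proof.
move=> SF bndF eigx x0.
have /andP[r_gt2 r_lt3] := sqrt5_bounds.
have symF := seidel_sym SF; have offF := seidel_offdiag SF.
have cardT : 1 <= #|T|%:R :> R.
  by rewrite (ler_nat _ 1); apply/card_gt0P; exists a.
have [b [c [ab ac bc abc]]] : exists b c,
    [/\ a != b, a != c, b != c & F a b * F b c * F a c = 1].
  apply: exists_triple eigx x0 _ _ => //; first by rewrite expr1n.
    by rewrite gt_eqF //; lra.
  by rewrite gt_eqF //; lra.
have [u [v [au av uv auv]]] : exists u v,
    [/\ a != u, a != v, u != v & F a u * F u v * F a v = -1].
  apply: exists_triple eigx x0 _ _ => //; first by rewrite sqrrN expr1n.
    by rewrite gt_eqF //; lra.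
  rewrite opprK mul1r -(natrB _ (_ : 0 < #|T|)%N) ?sqrt5_neq_nat //.
  by rewrite -(ler_nat R).
have [d us] : exists d, uniq [:: a; b; c; d].
  have new t : a != t -> t \notin [:: b; c] -> uniq [:: a; b; c; t].
    rewrite /= !inE !negb_or ab ac bc (eq_sym t b) (eq_sym t c).
    by move=> -> /andP[-> ->].
  have [ub|/new-/(_ au)] := boolP (u \in [:: b; c]); last by exists u.
  have [vb|/new-/(_ av)] := boolP (v \in [:: b; c]); last by exists v.
  exfalso; move: ub vb uv abc auv; rewrite !inE.
  move=> /orP[]/eqP-> /orP[]/eqP->; rewrite ?eqxx // => _ e1; first lra.
  by rewrite (symF c b) => e2; lra.
have [[_ _ ad] [_ bd cd]] := uniq4P us.
have pm p q t : p != q -> q != t -> p != t ->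
    F p q * F q t * F p t = 1 \/ F p q * F q t * F p t = -1.
  by move=> /offF pq /offF qt /offF pt; do 2 ?apply: pm1_mul.
have [abd|abd] := pm a b d ab bd ad.
  exists a, b, c, d; split=> //.
  by case: (pm a c d ac cd ad) => // acd; case: (no_positive_quadruple SF bndF us abc abd).
have [acd|acd] := pm a c d ac cd ad.
  exists a, c, b, d; split=> //; last by rewrite (symF c b) -abc; ring.
  by move: us; rewrite /= !inE !negb_or (eq_sym c b); do ! case: (_ == _).
exists b, c, a, d; split.
- by move: us; rewrite /= !inE !negb_or (eq_sym c a) (eq_sym b a); do ! case: (_ == _).
- by rewrite (symF c a) (symF b a) -abc; ring.
- rewrite (triple_third (seidel_sqr SF ab) (seidel_sqr SF ac) abc).
  rewrite (triple_third (seidel_sqr SF ab) (seidel_sqr SF ad) abd).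
  rewrite (triple_third (seidel_sqr SF ac) (seidel_sqr SF ad) acd).
  by case: (offF _ _ ab) => ->; case: (offF _ _ ac) => ->;
    case: (offF _ _ ad) => ->; lra.
- by rewrite (symF b a) -abd; ring.
Qed.

End SquareRootFive.
End SeidelKernels.

(** * The pentagon with an isolated vertex *)

Definition seidel_entry (R : pzRingType) (V : finType) (G : graph V) (u v : V) : R :=
  if u == v then 0 else (-1) ^+ adj G u v.

Notation C5K1 := (disjoint_union C5 (complete 1)).

Section Pentagon.
Variable R : realFieldType.

Lemma seidel_entry_kernel (V : finType) (G : graph V) :
  seidel_kernel (seidel_entry R G).
Proof.
split=> [u v|u|u v uv]; rewrite /seidel_entry ?eqxx //.
  by rewrite eq_sym adj_sym.
by rewrite (negPf uv); case: (adj _ _ _); [right|left]; rewrite ?expr1 ?expr0.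
Qed.

(** The Seidel matrix of C5 + K1 is a symmetric conference matrix of order 6:
    its square is 5 I. *)
Lemma C5K1_sqr (x : 'I_5 + 'I_1 -> R) :
  \sum_t apply_kernel (seidel_entry R C5K1) x t ^+ 2 = 5%:R * sq_norm x.
Proof.
rewrite /sq_norm /apply_kernel /seidel_entry !big_sumType /=.
rewrite !big_ord_recl !big_ord0 !big_sumType /= !big_ord_recl !big_ord0 /=.
by rewrite !expr0 !expr1; ring.
Qed.

Section SquareRootFive.
Variable r : R.
Hypotheses (r_ge0 : 0 <= r) (r2 : r ^+ 2 = 5%:R).

(** From [C ^ 2 = 5 I] one gets [(r I - C) ^ 2 = 2 r (r I - C)], which makes
    [r I - C] positive semidefinite. *)
Lemma C5K1_form_bounded : form_bounded (seidel_entry R C5K1) r.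
Proof.
move=> x; set C := seidel_entry R C5K1.
have /andP[r_gt2 _] := sqrt5_bounds r_ge0 r2.
have pos : 0 <= \sum_t (r * x t - apply_kernel C x t) ^+ 2.
  by apply: sumr_ge0 => t _; exact: sqr_ge0.
rewrite -subr_ge0 -(@pmulr_rge0 _ (2%:R * r)); last by lra.
congr (0 <= _): pos.
transitivity (r ^+ 2 * sq_norm x - 2%:R * r * quad_form C x
              + \sum_t apply_kernel C x t ^+ 2).
  rewrite /sq_norm /quad_form !mulr_sumr -sumrB -big_split /=.
  by apply: eq_bigr => t _; ring.
by rewrite C5K1_sqr -r2; ring.
Qed.

(** When the row of [a] is constantly 1, the negative entries among the other
    vertices form the cycle b, x, d, c, y, where x and y are the vertices
    outside the quadruple whose sign at c is 1 and -1 respectively. So [a]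
    goes to the isolated vertex and the others to the pentagon in this
    order. *)
Definition quadruple_map (T : finType) (F : T -> T -> R) (a b c d t : T)
    : 'I_5 + 'I_1 :=
  if t == a then inr ord0
  else if t == b then inl (@Ordinal 5 0 isT)
  else if t == d then inl (@Ordinal 5 2 isT)
  else if t == c then inl (@Ordinal 5 3 isT)
  else if F t c == 1 then inl (@Ordinal 5 1 isT)
  else inl (@Ordinal 5 4 isT).

Section NormalizedQuadruple.
Variables (T : finType) (F : T -> T -> R).
Hypotheses (SF : seidel_kernel F) (bndF : form_bounded F r).

Lemma quadruple_outside a b c d z :
  quadruple F a b c d -> (forall t, t != a -> F a t = 1) ->
  z \notin [:: a; b; c; d] -> F z b = -1 /\ F z d = - F z c.
Proof.
move=> quad Fa zs; have [us _ _ _] := quad.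
have [[ab ac ad] _] := uniq4P us.
have [eb ed] := quadruple_orthogonal r_ge0 r2 SF bndF quad zs.
move: zs; rewrite !inE !negb_or => /and4P[za zb zc zd].
split; first by move: eb; rewrite (seidel_sym SF z a) (Fa z) // (Fa b) 1?eq_sym // mul1r.
move: ed; rewrite (Fa c) 1?eq_sym // (Fa d) 1?eq_sym // mulr1.
by case: (seidel_offdiag SF zc) => ->; lra.
Qed.

(** The new vertex [z] forms with c, a, d another quadruple, with base pair cz
    and other pair ad. The orthogonality rule for this quadruple, applied to
    [z'], excludes that [z'] has the type of [z], and fixes the sign
    at zz'. *)
Lemma quadruple_outside_pair a b c d z z' :
  quadruple F a b c d -> (forall t, t != a -> F a t = 1) ->
  z \notin [:: a; b; c; d] -> z' \notin [:: a; b; c; d] -> z != z' ->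
  F z c = 1 -> F z' c = -1 /\ F z z' = 1.
Proof.
move=> quad Fa zs z's zz' Fzc; have [us _ _ acd] := quad.
have symF := seidel_sym SF.
have [[ab ac ad] [bc bd cd]] := uniq4P us.
have [Fzb Fzd] := quadruple_outside quad Fa zs.
have [Fz'b Fz'd] := quadruple_outside quad Fa z's.
have Fac : F a c = 1 by rewrite Fa // eq_sym.
have Fad : F a d = 1 by rewrite Fa // eq_sym.
have Fcd : F c d = -1 by move: acd; rewrite Fac Fad mul1r mulr1.
move: zs z's; rewrite !inE !negb_or => /and4P[za zb zc zd] /and4P[z'a z'b z'c z'd].
have quad' : quadruple F c z a d.
  split.
  - by rewrite /= !inE !negb_or (eq_sym c z) zc (eq_sym c a) ac cd za zd ad.
  - by rewrite (symF c z) (symF z a) (symF c a) Fzc (Fa z) // Fac !mulr1.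
  - by rewrite (symF c z) Fzc Fzd Fcd Fzc; lra.
  - by rewrite (symF c a) Fac Fad Fcd; lra.
have [|e1 e2] := quadruple_orthogonal r_ge0 r2 SF bndF quad' (z := z').
  by rewrite !inE !negb_or z'a z'c z'd eq_sym zz'.
move: e1 e2; rewrite (symF c z) (symF c a) (symF z' a) (symF z' z) Fzc Fcd Fac.
rewrite (Fa z') // Fz'd.
by case: (seidel_offdiag SF z'c) => ->; lra.
Qed.

Lemma quadruple_map_entry a b c d :
  quadruple F a b c d -> (forall t, t != a -> F a t = 1) ->
  let f := quadruple_map F a b c d in
  forall u v, F u v = seidel_entry R C5K1 (f u) (f v).
Proof.
move=> quad Fa f.
have symF := seidel_sym SF.
have [us abc abd acd] := quad.
have [[ab ac ad] [bc bd cd]] := uniq4P us.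
have ba : b != a by rewrite eq_sym.
have ca : c != a by rewrite eq_sym.
have da : d != a by rewrite eq_sym.
have cb : c != b by rewrite eq_sym.
have db : d != b by rewrite eq_sym.
have dc : d != c by rewrite eq_sym.
have Fbc : F b c = 1 by move: abc; rewrite !Fa // mul1r mulr1.
have Fbd : F b d = 1 by move: abd; rewrite !Fa // mul1r mulr1.
have Fcd : F c d = -1 by move: acd; rewrite !Fa // mul1r mulr1.
(* Exchanging c and d exchanges the two types of outside vertices. *)
have quad' : quadruple F a b d c.
  split=> //; last by rewrite (symF d c) -acd; ring.
  by rewrite /= !inE !negb_or ab ac ad bc bd dc.
have mem4 t u1 u2 u3 u4 :
  t != u1 -> t != u2 -> t != u3 -> t != u4 -> t \notin [:: u1; u2; u3; u4].
  by move=> h1 h2 h3 h4; rewrite !inE !negb_or h1 h2 h3 h4.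
have out z : z != a -> z != b -> z != c -> z != d ->
    F z b = -1 /\ (F z c = 1 /\ F z d = -1 \/ F z c = -1 /\ F z d = 1).
  move=> za zb zc zd; have [||-> ->] := quadruple_outside (z := z) quad => //.
    exact: mem4.
  by split=> //; case: (seidel_offdiag SF zc) => ->; [left|right]; rewrite ?opprK.
have outc z z' : z != a -> z != b -> z != c -> z != d ->
    z' != a -> z' != b -> z' != c -> z' != d -> z != z' ->
    F z c = 1 -> F z' c = -1 /\ F z z' = 1.
  by move=> *; apply: (quadruple_outside_pair quad) => //; exact: mem4.
have outd z z' : z != a -> z != b -> z != c -> z != d ->
    z' != a -> z' != b -> z' != c -> z' != d -> z != z' ->
    F z d = 1 -> F z' d = -1 /\ F z z' = 1.
  by move=> *; apply: (quadruple_outside_pair quad') => //; exact: mem4.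
move=> u v; have [->|uv] := eqVneq u v.
  by rewrite (seidel_diag SF) (seidel_diag (seidel_entry_kernel C5K1)).
move: uv; rewrite /f /quadruple_map.
have N1 : (-1 == 1 :> R) = false by apply/eqP; lra.
have [->|ua] := eqVneq u a; last have [->|ub] := eqVneq u b;
  last have [->|ud] := eqVneq u d; last have [->|uc] := eqVneq u c;
  last (have [Fub [[Fuc Fud]|[Fuc Fud]]] := out u ua ub uc ud;
        rewrite Fuc ?N1 ?eqxx);
  (have [->|va] := eqVneq v a; last have [->|vb] := eqVneq v b;
  last have [->|vd] := eqVneq v d; last have [->|vc] := eqVneq v c;
  last (have [Fvb [[Fvc Fvd]|[Fvc Fvd]]] := out v va vb vc vd;
        rewrite Fvc ?N1 ?eqxx)) => uv;
  rewrite /seidel_entry /= ?expr0 ?expr1;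
  first [ done | by rewrite Fa | by rewrite symF | by rewrite symF Fa
        | by have [] := outc u v ua ub uc ud va vb vc vd uv Fuc; lra
        | by have [] := outd u v ua ub uc ud va vb vc vd uv Fud; lra ].
Qed.

End NormalizedQuadruple.
End SquareRootFive.
End Pentagon.

(** * Classification up to switching *)

Section Classification.
Variable R : realFieldType.

(** Switching so that the row of the first vertex of a quadruple is constantly
    1 preserves all triple signs and the bound on the form, and reduces to
    [quadruple_map_entry]. Injectivity is automatic: distinct vertices
    have a nonzero entry, and the diagonal of the target vanishes. *)
Lemma switched_C5K1 (T : finType) (F : T -> T -> R) r x :
  0 <= r -> r ^+ 2 = 5%:R -> seidel_kernel F -> form_bounded F r ->
  eigenfun F r x -> (exists t, x t != 0) ->
  exists e f, switched F (seidel_entry R C5K1) e f.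
Proof.
move=> r_ge0 r2 SF bndF eigx x0; have [t0 _] := x0.
have [a [b [c [d [us abc abd acd]]]]] :=
  exists_quadruple r_ge0 r2 t0 SF bndF eigx x0.
pose e := base_sign F a.
have e2 t : e t ^+ 2 = 1 by exact: base_sign_sqr.
pose F' u v := e u * e v * F u v.
have SF' : seidel_kernel F'.
  split=> [u v|u|u v uv]; rewrite /F' ?(seidel_diag SF) ?mulr0 //.
    by rewrite (seidel_sym SF) [e u * _]mulrC.
  by apply: pm1_mul; [apply: pm1_mul; exact: sqr_eq1 | exact: seidel_offdiag].
have bndF' : form_bounded F' r by exact: form_bounded_switch.
have triple u v w : F' u v * F' v w * F' u w = F u v * F v w * F u w.
  transitivity (e u ^+ 2 * e v ^+ 2 * e w ^+ 2 * (F u v * F v w * F u w)).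
    by rewrite /F'; ring.
  by rewrite !e2 !mul1r.
have quad : quadruple F' a b c d by split=> //; rewrite triple.
have Fa t : t != a -> F' a t = 1.
  move=> ta; rewrite /F' /e /base_sign eqxx (negPf ta) mul1r -expr2.
  by rewrite (seidel_sqr SF) // eq_sym.
exists e, (quadruple_map F' a b c d).
have entry := quadruple_map_entry r_ge0 r2 SF' bndF' quad Fa.
split=> //.
  move=> u v fuv; apply/eqP/negPn/negP => uv.
  have := seidel_offdiag SF' uv; rewrite entry fuv.
  by rewrite (seidel_diag (seidel_entry_kernel R C5K1)); case; lra.
move=> u v; rewrite -entry /F'.
transitivity (e u ^+ 2 * e v ^+ 2 * F u v); last by ring.
by rewrite !e2 !mul1r.
Qed.

Lemma switched_edgeless3 (T : finType) (F : T -> T -> R) x :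
  seidel_kernel F -> form_bounded F 2%:R -> eigenfun F 2%:R x ->
  (exists t, x t != 0) ->
  exists e f, switched F (seidel_entry R (edgeless 3)) e f /\ bijective f.
Proof.
move=> SF bndF eigx x0; have [a _] := x0.
have [b [c [ab ac bc abc]]] : exists b c,
    [/\ a != b, a != c, b != c & F a b * F b c * F a c = 1].
  have cardT : 1 <= #|T|%:R :> R.
    by rewrite (ler_nat _ 1); apply/card_gt0P; exists a.
  apply: exists_triple eigx x0 _ _ => //; first by rewrite expr1n.
    by rewrite gt_eqF //; lra.
  by rewrite gt_eqF //; lra.
have all3 := positive_triple_spanning SF bndF ab ac bc abc.
have symF := seidel_sym SF.
pose f t : 'I_3 := if t == a then ord0 else if t == b then @Ordinal 3 1 isT
                   else @Ordinal 3 2 isT.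
have Fbc : F b c = F a b * F a c.
  by rewrite (triple_third (seidel_sqr SF ab) (seidel_sqr SF ac) abc) mul1r.
have ba : (b == a) = false by rewrite eq_sym (negPf ab).
have ca : (c == a) = false by rewrite eq_sym (negPf ac).
have cb : (c == b) = false by rewrite eq_sym (negPf bc).
have bijf : bijective f.
  exists (fun i : 'I_3 => nth a [:: a; b; c] i).
    move=> t; have := all3 t; rewrite !inE /f.
    by case/or3P=> /eqP->; rewrite ?eqxx ?ba ?ca ?cb.
  by case=> -[|[|[|//]]] i; apply/val_inj; rewrite /f /= ?eqxx ?ba ?ca ?cb.
exists (base_sign F a), f; split=> //; split=> [|t|u v]; first exact: bij_inj.
- exact: base_sign_sqr.
- have := all3 v; have := all3 u; rewrite !inE /f /base_sign.
  case/or3P=> /eqP-> /or3P[] /eqP->; rewrite ?eqxx ?ba ?ca ?cb ?eqxx;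
    rewrite /seidel_entry /= ?(seidel_diag SF) ?expr0 ?mulr0 ?mulr1 ?mul1r //.
  by rewrite (symF c b) Fbc mulrC.
Qed.

Lemma switched_switching_equivalent (V W : finType) (G : graph V) (H : graph W)
    (e : V -> R) (f : V -> W) :
  switched (seidel_entry R G) (seidel_entry R H) e f -> bijective f ->
  switching_equivalent G H.
Proof.
case=> injf e2 GH bijf; exists [set u | e u == -1]; exists f => // u v.
rewrite /= /switch_adj !inE; have := GH u v; rewrite /seidel_entry (inj_eq injf).
have [->|uv] := eqVneq u v; first by rewrite !adj_irr addbb.
have N1 : (-1 == 1 :> R) = false by apply/eqP; lra.
case: (sqr_eq1 (e2 u)) (sqr_eq1 (e2 v)) => -> [] ->; case: (adj G u v); case: (adj H (f u) (f v));
  rewrite ?eqxx ?(eq_sym 1) ?N1 //= ?expr0 ?expr1; lra.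
Qed.

(** * From matrices to graphs *)

Lemma eigenvalue_eigenfun n (S : 'M[R]_n) mu :
  S^T = S ->
  eigenvalue S mu <-> exists x, eigenfun S mu x /\ exists i, x i != 0.
Proof.
move=> symS; have symS' i j : S i j = S j i by rewrite -[in LHS]symS mxE.
split=> [/eigenvalueP[v vS v0]|[x [eigx [i xi]]]].
  exists (v 0); split.
    move=> i; have /rowP/(_ i) := vS; rewrite !mxE => <-.
    by apply: eq_bigr => j _; rewrite symS' mulrC.
  by apply/existsP; apply: contraNT v0; rewrite negb_exists => /forallP v0;
    apply/eqP/rowP => i; rewrite mxE; apply/eqP/negPn.
apply/eigenvalueP; exists (\row_j x j).
  apply/rowP => j; rewrite !mxE -eigx; apply: eq_bigr => k _.
  by rewrite mxE symS' mulrC.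
by apply/eqP => /rowP/(_ i)/eqP; rewrite !mxE (negPf xi).
Qed.

Lemma form_bounded_largest_eigenvalue n (S : 'M[R]_n) lambda x :
  S^T = S -> form_bounded S lambda -> eigenfun S lambda x ->
  (exists i, x i != 0) -> largest_eigenvalue S lambda.
Proof.
move=> symS bndS eigx x0; split.
  by apply/(eigenvalue_eigenfun _ symS); exists x.
move=> mu /(eigenvalue_eigenfun _ symS)[y [eigy [i yi]]].
have := bndS y; rewrite (eigenfun_quad_form eigy) ler_pM2r //.
rewrite /sq_norm (bigD1 i) //= ltr_wpDr ?sumr_ge0 // => [j _|].
  exact: sqr_ge0.
by rewrite lt_neqAle sqr_ge0 eq_sym sqrf_eq0 yi.
Qed.

Lemma largest_eigenvalue_unique n (S : 'M[R]_n) lambda mu :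
  largest_eigenvalue S lambda -> largest_eigenvalue S mu -> lambda = mu.
Proof.
move=> [eigl maxl] [eigm maxm]; apply/le_anti.
by rewrite (maxm _ eigl) (maxl _ eigm).
Qed.

Lemma seidel_mxE (V : finType) (G : graph V) i j :
  seidel_mx R G i j = seidel_entry R G (enum_val i) (enum_val j).
Proof.
rewrite !mxE /seidel_entry (inj_eq enum_val_inj).
have [->|ij] := eqVneq i j; first by rewrite adj_irr mulr0 subr0 subrr.
by case: (adj _ _ _); rewrite ?expr1 ?expr0 /=; lra.
Qed.

Lemma seidel_mx_sym (V : finType) (G : graph V) :
  (seidel_mx R G)^T = seidel_mx R G.
Proof.
apply/matrixP => i j; rewrite mxE !seidel_mxE.
exact: (seidel_sym (seidel_entry_kernel R G)).
Qed.

Lemma form_bounded_ext (T : finType) (F F' : T -> T -> R) lambda :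
  F =2 F' -> form_bounded F lambda -> form_bounded F' lambda.
Proof.
move=> FF' bndF x; congr (_ <= _): (bndF x); apply: eq_bigr => t _.
by congr (_ * _); apply: eq_bigr => v _; rewrite FF'.
Qed.

(** Adding the missed vertex [w] to the image of [f] gives a principal
    submatrix of the switched matrix of [H], whose form is still bounded by
    [lambda]; an eigenvector of [G] for [lambda], extended by zero, remains
    one. *)
Lemma switched_not_strongly_maximal (V W : finType) (G : graph V)
    (H : graph W) (e : V -> R) (f : V -> W) (w : W) lambda :
  switched (seidel_entry R G) (seidel_entry R H) e f ->
  form_bounded (seidel_entry R H) lambda ->
  largest_eigenvalue (seidel_mx R G) lambda ->
  (forall v, f v != w) -> ~ strongly_maximal R G.
Proof.
move=> [injf e2 GH] bndH largeG fw [_ [mu largeG' maxG]].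
rewrite -(largest_eigenvalue_unique largeG largeG') in maxG; apply: maxG.
pose n := #|V|.
pose f' (i : 'I_(n + 1)) : W :=
  if split i is inl j then f (enum_val j) else w.
pose e' (i : 'I_(n + 1)) : R :=
  if split i is inl j then e (enum_val j) else 1.
pose S' : 'M[R]_(n + 1) :=
  \matrix_(i, j) (e' i * e' j * seidel_entry R H (f' i) (f' j)).
have SH := seidel_entry_kernel R H.
have e'2 i : e' i ^+ 2 = 1 by rewrite /e'; case: split => *; rewrite ?expr1n.
have injf' : injective f'.
  move=> i j; rewrite /f' -{2}(splitK i) -{2}(splitK j).
  case: (split i) (split j) => [i'|i'] [j'|j'] /=.
  - by move/injf/enum_val_inj->.
  - by move/eqP; rewrite (negPf (fw _)).
  - by move/esym/eqP; rewrite (negPf (fw _)).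
  - by rewrite !ord1.
have symS' : S'^T = S'.
  by apply/matrixP => i j; rewrite !mxE (seidel_sym SH) [e' j * _]mulrC.
have subS : forall i j, seidel_mx R G i j = S' (lshift 1 i) (lshift 1 j).
  move=> i j; rewrite seidel_mxE GH mxE /e' /f'.
  by rewrite !(unsplitK (inl _ : 'I_n + 'I_1)).
have bndS' : form_bounded S' lambda.
  have := form_bounded_switch e'2 (form_bounded_restrict injf' bndH).
  by apply: form_bounded_ext => i j; rewrite mxE.
have [x [eigx [i xi]]] :=
  (eigenvalue_eigenfun lambda (seidel_mx_sym G)).1 largeG.1.
exists (n + 1)%N, S'; split.
- split=> // [k|k l kl]; first by rewrite mxE (seidel_diag SH) mulr0.
  rewrite mxE.
  apply: pm1_mul; first by apply: pm1_mul; exact: sqr_eq1.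
  by apply: (seidel_offdiag SH); rewrite (inj_eq injf').
- apply: (form_bounded_largest_eigenvalue (x := pushforward (lshift 1) x)) => //.
    apply: eigenfun_pushforward => //; first by move=> *; rewrite -{1}symS' mxE.
      exact: lshift_inj.
    move=> k; rewrite -eigx; apply: eq_bigr => j _.
    by rewrite subS.
  by exists (lshift 1 i); rewrite pushforward_inj //; exact: lshift_inj.
- split; first by rewrite addn1.
  by exists (lshift 1) => //; apply/matrixP => k j; rewrite subS [RHS]mxE.
Qed.
End Classification.

Lemma largest_eigenvalue_form_bounded (R : rcfType) (V : finType) (G : graph V) lambda :
  largest_eigenvalue (seidel_mx R G) lambda ->
  form_bounded (seidel_entry R G) lambda /\
  exists x, eigenfun (seidel_entry R G) lambda x /\ exists t, x t != 0.
Proof.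
move=> largeG; have symS := seidel_mx_sym R G; split.
  have bndS : form_bounded (seidel_mx R G) lambda.
    move=> x; have := largest_eigenvalue_rayleigh (\row_i x i) symS largeG.
    congr (_ <= _ * _).
      rewrite -mulmxA mxE; apply: eq_bigr => i _; rewrite !mxE; congr (_ * _).
      by apply: eq_bigr => j _; rewrite !mxE.
    by rewrite mxE; apply: eq_bigr => i _; rewrite !mxE expr2.
  apply: form_bounded_ext (form_bounded_restrict enum_rank_inj bndS) => u v.
  by rewrite seidel_mxE !enum_rankK.
have [x [eigx [i xi]]] := (eigenvalue_eigenfun lambda symS).1 largeG.1.
exists (x \o enum_rank); split; last by exists (enum_val i); rewrite /= enum_valK.
move=> u; rewrite /= -eigx /apply_kernel (reindex_onto enum_val enum_rank) /=; last first.
  by move=> v _; rewrite enum_rankK.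
apply: eq_big => [j|j _]; first by rewrite enum_valK eqxx.
by rewrite seidel_mxE enum_rankK enum_valK.
Qed.

Theorem proposition5p6 (R : rcfType) :
  (forall (V : finType) (G : graph V),
      largest_eigenvalue (seidel_mx R G) 2%:R ->
      strongly_maximal R G ->
      switching_equivalent G (edgeless 3)) /\
  (forall (V : finType) (G : graph V),
      largest_eigenvalue (seidel_mx R G) (Num.sqrt 5%:R) ->
      strongly_maximal R G ->
      switching_equivalent G (disjoint_union C5 (complete 1))).
Proof.
split=> V G largeG maxG.
  have [bndG [x [eigx x0]]] := largest_eigenvalue_form_bounded largeG.
  have [e [f [GH bijf]]] :=
    switched_edgeless3 (seidel_entry_kernel R G) bndG eigx x0.
  exact: switched_switching_equivalent GH bijf.
have r_ge0 := sqrtr_ge0 (5%:R : R).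
have r2 : Num.sqrt (5%:R : R) ^+ 2 = 5%:R by rewrite sqr_sqrtr // ler0n.
have [bndG [x [eigx x0]]] := largest_eigenvalue_form_bounded largeG.
have [e [f GH]] :=
  switched_C5K1 r_ge0 r2 (seidel_entry_kernel R G) bndG eigx x0.
apply: (switched_switching_equivalent GH).
have [/forallP surjf|] := boolP [forall w, [exists v, f v == w]].
  apply: inj_card_bij; first by case: GH.
  have -> : #|{: 'I_5 + 'I_1}| = #|codom f|.
    by apply/esym/eq_card => w; apply/codomP; have /existsP[v /eqP<-] := surjf w; exists v.
  by rewrite card_codom //; case: GH.
rewrite negb_forall => /existsP[w]; rewrite negb_exists => /forallP fw.
by case: (switched_not_strongly_maximal GH (C5K1_form_bounded r_ge0 r2) largeG fw).
Qed.
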